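(* Let $N_1=(V_1,R_1,S_1,\tau_1,d_1,n_1)$ and $N_2=(V_2,R_2,S_2,\tau_2,d_2,n_2)$ be valid NU-systems generating strings $w_1$ and $w_2$, respectively. Then there is a valid NU-system of size $O(size(N_1)+size(N_2))$ generating $w_1\cdot w_2$, and (when $w_1\in V_2^*$) there is a valid NU-system of size $O(size(N_1)+size(N_2))$ generating the composition of $w_1$ and $w_2$, namely the string generated by the NU-system $(V_2,R_2,w_1,\tau_2,d_2,n_2)$ whose axiom is $w_1$.
   Context: NU-system: a tuple $N=(V,R,S,\tau,d,n)$ where $V$ is a finite set of variables, $S\in V^*$ is the axiom, $\tau:V\to V$ is a coding (letter-to-letter, extended letter-wise), $d,n\in\mathbb{N}$, and $R$ assigns to each $A\in V$ a right-hand side $R(A)\in(V\cup E)^+$, where $E=\{A(l)[i,j] : A\in V,\ l,i,j\in\mathbb{N}\}$ is the set of extraction symbols. For a variable $A$ let $A_0=A$ and let $A_{l+1}$ be obtained from $A_l$ by replacing each variable $B$ by $R(B)$, where every extraction symbol $B(l')[i,j]$ in a right-hand side is in turn replaced by the string $\tau(B_{l'}[i,j])\in V^*$ (its $l'$-level expansion, with extractions recursively resolved, restricted to positions $i..j$ and mapped by $\tau$); this replacement counts as a single level. The levels of $N$ are $L_0=S$ and $L_{i+1}$ obtained from $L_i$ in the same way. $A(l)$ abbreviates $A(l)[1,|A_l|]$. $N$ is valid if this recursive resolution has no circular dependencies, so all levels are uniquely determined; it then generates $w[1,n]=\tau(L_d[1,n])$. Its size $size(N)$ is $|S|+\sum_{A\in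 V}|R(A)|$, each extraction symbol counting as one. The $O(\cdot)$ hides an absolute constant. *)

(* Defs.v *)
From HB Require Import structures.
From mathcomp Require Import all_boot finmap.

Set Implicit Arguments.
Unset Strict Implicit.
Unset Printing Implicit Defensive.

(* All alphabets are finite subsets of an ambient type [T] of symbols, so that
   strings over different systems can be concatenated and compared.           *)

(* [Ext A l i j] is the extraction symbol A(l)[i,j], with 1-based inclusive
   bounds.                                                                    *)
Inductive nu_symbol (T : Type) : Type :=
  | Var of T
  | Ext of T & nat & nat & nat.

Definition symbol_var (T : Type) (x : nu_symbol T) : T :=
  match x with Var A => A | Ext A _ _ _ => A end.

(* [nu_rule] and [nu_coding] are total on [T] for convenience; only their
   values on [nu_vars] matter.                                                *)
Record nu_system (T : choiceType) := NUSystem {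
  nu_vars : {fset T};
  nu_rule : T -> seq (nu_symbol T);
  nu_axiom : seq T;
  nu_coding : T -> T;
  nu_depth : nat;
  nu_length : nat
}.

Section NUSystems.
Variable T : choiceType.
Implicit Types (N : nu_system T) (A B C c : T) (e : T -> seq T).

Definition nu_wf N : Prop :=
  [/\ {subset nu_axiom N <= nu_vars N},
      {in nu_vars N, forall A, nu_coding N A \in nu_vars N},
      {in nu_vars N, forall A, 0 < size (nu_rule N A)} &
      {in nu_vars N, forall A,
        all (fun x => symbol_var x \in nu_vars N) (nu_rule N A)}].

Definition nu_size N : nat :=
  size (nu_axiom N) + \sum_(A <- nu_vars N) size (nu_rule N A).

(* The length of the string that replaces a symbol: A(l)[i,j] stands for
   j - i + 1 letters.  If [i,j] is nonempty and sticks out of A_l, some of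
   these letters do not exist; [letter_at] is then undefined there and the
   system is not valid.                                                       *)
Definition symbol_len (x : nu_symbol T) : nat :=
  match x with Var _ => 1 | Ext _ _ i j => j.+1 - i end.

Definition rule_len N A : nat := sumn (map symbol_len (nu_rule N A)).

(* Recursive resolution, position by position (0-based):
   - [letter_at N A l p c] : the letter of A_l at position p resolves to c;
   - [rule_at N A p c] : so does the letter at position p of the string that
     replaces A in one level, i.e. R(A) with its extractions resolved.
   Being inductive, these predicates only hold when the resolution is
   well-founded.  Locating a position of A_(l+1) requires the letters of A_l
   up to the one it comes from ([u] followed by [B]); an extracted letter
   only requires the letter that it copies, so a rule may copy from a string
   that it takes part in, as in bidirectional macro schemes.                  *)
Inductive letter_at N : T -> nat -> nat -> T -> Prop :=
  | LetterAt0 A : letter_at N A 0 0 A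
  | LetterAtS A l u B p c :
      (forall q, q < size u -> letter_at N A l q (nth B u q)) ->
      letter_at N A l (size u) B ->
      rule_at N B p c ->
      letter_at N A l.+1 (sumn (map (rule_len N) u) + p) c
with rule_at N : T -> nat -> T -> Prop :=
  | RuleAtVar A s1 B s2 :
      nu_rule N A = s1 ++ Var B :: s2 ->
      rule_at N A (sumn (map symbol_len s1)) B
  | RuleAtExt A s1 B l i j s2 q c :
      nu_rule N A = s1 ++ Ext B l i j :: s2 ->
      i <= q.+1 <= j ->
      letter_at N B l q c ->
      rule_at N A (sumn (map symbol_len s1) + (q.+1 - i)) (nu_coding N c).

(* [e] maps every variable to its fully resolved one-level replacement. *)
Definition nu_resolves N e : Prop :=
  {in nu_vars N, forall A,
     size (e A) = rule_len N A /\
     forall p, p < size (e A) -> rule_at N A p (nth A (e A) p)}.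

Definition nu_valid N : Prop := nu_wf N /\ exists e, nu_resolves N e.

Definition expand e (l : nat) (s : seq T) : seq T :=
  iter l (fun u => flatten (map e u)) s.

Definition nu_generates N (w : seq T) : Prop :=
  exists2 e, nu_resolves N e &
    w = map (nu_coding N)
          (take (nu_length N) (expand e (nu_depth N) (nu_axiom N))).

Definition nu_with_axiom N (s : seq T) : nu_system T :=
  NUSystem (nu_vars N) (nu_rule N) s (nu_coding N) (nu_depth N) (nu_length N).

End NUSystems.

(* Main.v *)
(* The second system is kept verbatim, so that its letters print and expand as
   before.  The coding of the first system is needed both inside extractions,
   where it must produce letters that go on expanding, and for the final
   output, where it must not; a single coding cannot do both on one letter.
   Hence every letter A of the first system is doubled into Work A -> Read A
   -> R(A), where R(A) is rewritten over the Work letters.  Levels are doubled: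
   extractions in the rules read even levels, made of Work letters, which are
   coded to Work letters.  The odd level 2 d1 + 1 consists of Read letters,
   whose coding is free.  One extraction from that level inserts w1 into
   the rule of the new axiom, either as idle letters followed by the second
   axiom (concatenation) or as letters of the second system (composition).     *)

From HB Require Import structures.
Require Import Defs.
From mathcomp Require Import all_boot finmap.
From mathcomp Require Import zify.

Set Implicit Arguments.
Unset Strict Implicit.
Unset Printing Implicit Defensive.

Scheme letter_at_mut := Minimality for letter_at Sort Prop
  with rule_at_mut := Minimality for rule_at Sort Prop.
Combined Scheme letter_rule_at_ind from letter_at_mut, rule_at_mut.

(** * Reading prefixes of levels, and what makes a letter resolved *)

Section Reading.
Variable T : choiceType.
Implicit Types (N : nu_system T) (A B c : T) (u s : seq T) (e : T -> seq T).

(** Only a prefix of the level is concerned: [u] may be shorter than [A_l]. The default of [nth] is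
    never reached. *)
Definition reads N A l u :=
  forall q, q < size u -> letter_at N A l q (nth A u q).

Definition resolved N e A :=
  size (e A) = rule_len N A /\
  forall p, p < size (e A) -> rule_at N A p (nth A (e A) p).

(** This form is free of [nth] and of its default, so passing to a prefix of [u] is a matter of
    splitting lists. *)
Lemma readsP N A l u :
  reads N A l u <->
  (forall u1 B u2, u = u1 ++ B :: u2 -> letter_at N A l (size u1) B).
Proof.
split=> [ru u1 B u2 uE | ru q qu].
  have := ru (size u1); rewrite uE size_cat /= addnS ltnS leq_addr.
  by rewrite nth_cat ltnn subnn; apply.
have := ru (take q u) (nth A u q) (drop q.+1 u).
by rewrite size_takel ?(ltnW qu) // -drop_nth // cat_take_drop; apply.
Qed.

Lemma letter_atS N A l u B p c :
  reads N A l (rcons u B) -> rule_at N B p c ->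
  letter_at N A l.+1 (sumn (map (rule_len N) u) + p) c.
Proof.
move=> ru Bp; apply: LetterAtS Bp.
  move=> q qu; have := ru q; rewrite size_rcons ltnS ltnW // => /(_ isT).
  by rewrite nth_rcons qu (set_nth_default B).
have := ru (size u).
by rewrite size_rcons leqnn nth_rcons ltnn eqxx; apply.
Qed.

Lemma flatten_map_split e u x p : p < size (flatten (map e u)) ->
  exists u1 B u2 r,
    [/\ u = u1 ++ B :: u2, p = sumn (map (size \o e) u1) + r, r < size (e B)
      & nth x (flatten (map e u)) p = nth x (e B) r].
Proof.
elim: u p => //= B u IHu p; rewrite size_cat.
have [pB _ | Bp pu] := ltnP p (size (e B)).
  by exists [::], B, u, p; rewrite nth_cat pB.
have [|u1 [C [u2 [r [-> pE rC nthE]]]]] := IHu (p - size (e B)).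
  by rewrite ltn_subLR.
exists (B :: u1), C, u2, r; split=> //=; first by rewrite -addnA -pE subnKC.
by rewrite nth_cat ltnNge Bp /= nthE.
Qed.

(** A position of the new level lies in the block of one letter [B] of [u]. The blocks before it
    have the lengths that [rule_len] predicts, and [letter_atS] asks only for the prefix of [u] that
    ends in this [B]. *)
Lemma reads_flatten N e A l u :
  {in u, forall B, resolved N e B} ->
  reads N A l u -> reads N A l.+1 (flatten (map e u)).
Proof.
move=> res ru p pu.
have [u1 [B [u2 [r [uE -> rB ->]]]]] := flatten_map_split A pu.
have [uB Br]: resolved N e B by apply: res; rewrite uE mem_cat mem_head orbT.
have -> : map (size \o e) u1 = map (rule_len N) u1.
  apply/eq_in_map => C Cu1; have [] // := res C.
  by rewrite uE mem_cat Cu1.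
apply: letter_atS; last by rewrite (set_nth_default B) //; apply: Br.
apply/readsP => v1 C v2 vE; move/readsP: ru => /(_ v1 C (v2 ++ u2)); apply.
by rewrite uE -cat_rcons vE -catA.
Qed.

Lemma expandSr e l s : expand e l.+1 s = expand e l (flatten (map e s)).
Proof. by rewrite /expand iterSr. Qed.

Lemma expand_cat e l s1 s2 : expand e l (s1 ++ s2) = expand e l s1 ++ expand e l s2.
Proof. by elim: l s1 s2 => // l IHl s1 s2; rewrite !expandSr map_cat flatten_cat IHl. Qed.

Lemma sub_flatten_map e (U : {pred T}) s :
  {in U, forall A, {subset e A <= U}} -> {subset s <= U} ->
  {subset flatten (map e s) <= U}.
Proof. by move=> eU sU x /flatten_mapP[A /sU AU] /(eU _ AU). Qed.

Lemma sub_expand e (U : {pred T}) l s :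
  {in U, forall A, {subset e A <= U}} -> {subset s <= U} ->
  {subset expand e l s <= U}.
Proof. by move=> eU sU; elim: l => //= l IHl; apply: sub_flatten_map. Qed.

(** Working inside a closed set [U] allows levels to be read before every letter of [N] is known to
    be resolved. *)
Lemma reads_expand N e (U : {pred T}) A l :
  {in U, forall B, resolved N e B} -> {in U, forall B, {subset e B <= U}} ->
  A \in U -> reads N A l (expand e l [:: A]).
Proof.
move=> res eU AU; elim: l => [|l IHl] /=.
  by case=> // _; apply: LetterAt0.
apply: reads_flatten IHl => B /(sub_expand eU (s := [:: A])) BU.
by apply/res/BU => x /[!inE] /eqP ->.
Qed.

Lemma sumn_symbol_len_Var u : sumn (map (@symbol_len T) (map (@Var T) u)) = size u.
Proof. by elim: u => //= B u ->. Qed.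

Lemma rule_at_Var N A r u p :
  nu_rule N A = r ++ map (@Var T) u -> p < size u ->
  rule_at N A (sumn (map (@symbol_len T) r) + p) (nth A u p).
Proof.
move=> AE pu.
have := @RuleAtVar T N A (r ++ map (@Var T) (take p u)) (nth A u p)
  (map (@Var T) (drop p.+1 u)).
rewrite map_cat sumn_cat sumn_symbol_len_Var size_takel ?(ltnW pu) //; apply.
by rewrite AE -catA -map_cons -map_cat -drop_nth // cat_take_drop.
Qed.

Lemma resolved_Var N e A : nu_rule N A = map (@Var T) (e A) -> resolved N e A.
Proof.
move=> AE; split=> [|p pA]; first by rewrite /rule_len AE sumn_symbol_len_Var.
exact: (@rule_at_Var _ _ [::]).
Qed.

End Reading.

(** * Simulation of one system by another with idle levels *)

(** Level [l] of the simulated system reappears as level [l * k.+1], so extractions must read that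
    level. *)
Definition stretch (T : Type) (k : nat) (f : T -> T) (y : nu_symbol T) : nu_symbol T :=
  match y with
  | Var B => Var (f B)
  | Ext B l i j => Ext (f B) (l * k.+1) i j
  end.

Lemma map_stretch_id (T : Type) (r : seq (nu_symbol T)) : map (stretch 0 id) r = r.
Proof. by rewrite -[RHS]map_id; apply: eq_map => -[] //= B l i j; rewrite muln1. Qed.

(* [N] simulates [M] with [k] idle levels inserted before each level of [M]. *)
Section Simulation.
Variables (T : choiceType) (k : nat) (f g : T -> T) (M N : nu_system T).

Hypothesis wfM : nu_wf M.
Hypothesis ruleE : {in nu_vars M, forall A, nu_rule N (g A) = map (stretch k f) (nu_rule M A)}.
Hypothesis codingE : {in nu_vars M, forall A, nu_coding N (f A) = f (nu_coding M A)}.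
Hypothesis pad : forall A l u, {subset u <= nu_vars M} ->
  reads N A l (map f u) -> reads N A (l + k) (map g u).

Lemma map_symbol_len_stretch r :
  map (@symbol_len T) (map (stretch k f) r) = map (@symbol_len T) r.
Proof. by rewrite -map_comp; apply: eq_map => -[]. Qed.

Lemma rule_len_stretch : {in nu_vars M, forall A, rule_len N (g A) = rule_len M A}.
Proof. by move=> A AM; rewrite /rule_len ruleE // map_symbol_len_stretch. Qed.

(** Mutual induction on derivations. The copies by [f] are the letters that extractions read, and
    the copies by [g] carry the rules; [pad] spends [k] levels on turning the former into the
    latter. Membership in [nu_vars M] is carried along because the hypotheses hold only there. *)
Lemma simulate :
  (forall A l p c, letter_at M A l p c -> A \in nu_vars M ->
     c \in nu_vars M /\ letter_at N (f A) (l * k.+1) p (f c)) /\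
  (forall A p c, rule_at M A p c -> A \in nu_vars M ->
     c \in nu_vars M /\ rule_at N (g A) p (f c)).
Proof.
have [_ codM _ ruleM] := wfM.
apply: letter_rule_at_ind => /=.
- by move=> A AM; split=> //; apply: LetterAt0.
- move=> A l u B p c _ IHu _ IHB _ IHc AM.
  have [BM BN] := IHB AM; have [cM cN] := IHc BM; split=> //.
  have uM: {subset u <= nu_vars M}.
    by move=> C /(nthP B)[q qu <-]; have [] := IHu q qu AM.
  have -> : map (rule_len M) u = map (rule_len N) (map g u).
    by rewrite -map_comp; apply/eq_in_map => C /uM /rule_len_stretch.
  (* The level [l.+1 * k.+1] splits into [l * k.+1], then [k] idle levels, then one level that
     applies the rule. *)
  rewrite mulSn addnC addnS; apply: (letter_atS _ cN).
  rewrite -map_rcons; apply: pad.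
    by move=> C; rewrite mem_rcons inE => /predU1P[-> | /uM].
  move=> q; rewrite size_map size_rcons ltnS leq_eqVlt => /predU1P[-> | qu].
    by rewrite (nth_map B) ?size_rcons // nth_rcons ltnn eqxx.
  rewrite (nth_map B) ?size_rcons ?ltnS ?(ltnW qu) // nth_rcons qu.
  by have [] := IHu q qu AM.
- move=> A s1 B s2 AE AM; have := ruleM A AM; rewrite AE all_cat /=.
  case/and3P=> _ BM _; split=> //; rewrite -map_symbol_len_stretch.
  by apply: (RuleAtVar (s2 := map (stretch k f) s2)); rewrite ruleE // AE map_cat.
- move=> A s1 B l i j s2 q c AE iqj _ IHc AM.
  have := ruleM A AM; rewrite AE all_cat /= => /and3P[_ BM _].
  have [cM cN] := IHc BM; split; first exact: codM.
  rewrite -map_symbol_len_stretch -codingE //.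
  by apply: RuleAtExt iqj cN; rewrite ruleE // AE map_cat.
Qed.

Lemma resolved_stretch e e' A : nu_resolves M e -> A \in nu_vars M ->
  e' (g A) = map f (e A) -> resolved N e' (g A).
Proof.
move=> res AM e'E; have [sA At] := res A AM; rewrite /resolved e'E size_map.
split=> [|p pA]; first by rewrite sA rule_len_stretch.
by rewrite (nth_map A) //; have [_ /(_ A _ _ (At p pA) AM)[]] := simulate.
Qed.

End Simulation.

(** Every system simulates itself with no idle level; the membership half of [simulate] then gives
    the claim. *)
Lemma resolved_in_vars (T : choiceType) (N : nu_system T) e A : nu_wf N ->
  nu_resolves N e -> A \in nu_vars N -> {subset e A <= nu_vars N}.
Proof.
move=> wf res AN x /(nthP A)[p pA <-]; have [_ /(_ p pA) At] := res A AN.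
have [|||_ /(_ _ _ _ At AN)[]//] := @simulate T 0 id id N N wf.
- by move=> B _; rewrite map_stretch_id.
- by [].
- by move=> B l u _; rewrite addn0 map_id.
Qed.

(** * Fresh letters and their roles *)

(** The partial inverse [dec] gives more than an injection: it tells new letters from old ones, so
    rules and codings can be defined by matching on it. Letters are chosen one key at a time, each
    outside [X] and outside the codes already given. *)
Lemma fresh_coding (T : choiceType)
    (T_infinite : forall X : {fset T}, exists x : T, x \notin X)
    (K : eqType) (ks : seq K) (X : {fset T}) :
  exists (f : K -> T) (dec : T -> option K),
    {in ks, forall k, dec (f k) = Some k} /\ {in X, forall x, dec x = None}.
Proof.
elim: ks => [|k ks [f [dec [decf decX]]]].
  by have [x _] := T_infinite fset0; exists (fun=> x), (fun=> None).
have [x] := T_infinite (X `|` [fset y in map f ks])%fset.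
rewrite !inE negb_or => /andP[xX xks].
exists (fun y => if y == k then x else f y), (fun z => if z == x then Some k else dec z).
split=> [y|z zX]; last by case: eqP zX xX => [->|_ /decX //] ->.
rewrite inE; case: eqP => [-> _|_ /= yks]; first by rewrite eqxx.
by case: eqP => [fyx|_]; [rewrite -fyx map_f in xks | apply: decf].
Qed.

(* [Final A] is an idle letter printed as [A]; [Base] expands to the first
   axiom and [Top] is the axiom of the combined system.                      *)
Inductive role (T : Type) : Type :=
  | Work of T
  | Read of T
  | Final of T
  | Base
  | Top.
Arguments Base {T}.
Arguments Top {T}.

(** Embedding into a sum type serves to transfer decidable equality to [role T]. *)
Definition role_code (T : Type) (r : role T) : T + T + T + bool :=
  match r with
  | Work A => inl (inl (inl A))
  | Read A => inl (inl (inr A))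
  | Final A => inl (inr A)
  | Base => inr false
  | Top => inr true
  end.

Definition role_decode (T : Type) (x : T + T + T + bool) : role T :=
  match x with
  | inl (inl (inl A)) => Work A
  | inl (inl (inr A)) => Read A
  | inl (inr A) => Final A
  | inr false => Base
  | inr true => Top
  end.

Lemma role_codeK (T : Type) : cancel (@role_code T) (@role_decode T).
Proof. by case. Qed.

HB.instance Definition _ (T : choiceType) :=
  Equality.copy (role T) (can_type (@role_codeK T)).

(** Bounds a sum over a set of letters by the sum over a list of them, without a proof that the list
    has no repetition. *)
Lemma leq_sum_undup (I : eqType) (r : seq I) (F : I -> nat) :
  \sum_(i <- undup r) F i <= \sum_(i <- r) F i.
Proof.
elim: r => //= i r IHr; rewrite big_cons.
by case: ifP => _; rewrite ?big_cons ?leq_add2l // (leq_trans IHr) ?leq_addl.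
Qed.

(** * The combined system, with parameters covering both constructions *)

Section Combination.
Variables (T : choiceType) (N1 N2 : nu_system T) (e1 e2 : T -> seq T).
Variables (f : role T -> T) (dec : T -> option (role T)).
Variables (out : T -> T) (s : seq T) (n : nat).

Let V1 := nu_vars N1.
Let V2 := nu_vars N2.
Let work A := f (Work A).
Let read A := f (Read A).
Let final A := f (Final A).
Let w1 := map (nu_coding N1) (take (nu_length N1) (expand e1 (nu_depth N1) (nu_axiom N1))).

Definition roles : seq (role T) :=
  [:: Base; Top] ++ map (@Work T) V1 ++ map (@Read T) V1 ++ map (@Final T) V1.

(** The letters of [V1] outside [V2] belong here because codings produce them: [Final A] is coded to
    [A]. *)
Definition combined_letters : seq T :=
  V2 ++ [seq A <- V1 | A \notin V2] ++ map work V1 ++ map read V1 ++ map final V1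
     ++ [:: f Base; f Top].

(** [Base] ends its own rule, which keeps the rule nonempty when the first axiom is empty and only
    adds letters behind the wanted prefix. In the level read by [Top], one unit unfolds [Base],
    [nu_depth N1 * 2] simulate the first system, and one turns [Work] into [Read]. *)
Definition combined_rule x : seq (nu_symbol T) :=
  match dec x with
  | Some (Work A) => [:: Var (read A)]
  | Some (Read A) => map (stretch 1 work) (nu_rule N1 A)
  | Some (Final A) => [:: Var x]
  | Some Base => map (@Var T) (rcons (map work (nu_axiom N1)) x)
  | Some Top => Ext (f Base) (nu_depth N1 * 2).+2 1 (size w1) :: map (@Var T) s
  | None => if x \in V2 then nu_rule N2 x else [:: Var x]
  end.

Definition combined_coding x : T :=
  match dec x with
  | Some (Work A) => work (nu_coding N1 A)
  | Some (Read A) => out (nu_coding N1 A)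
  | Some (Final A) => A
  | Some _ => x
  | None => if x \in V2 then nu_coding N2 x else x
  end.

Definition combined_step x : seq T :=
  match dec x with
  | Some (Work A) => [:: read A]
  | Some (Read A) => map work (e1 A)
  | Some (Final A) => [:: x]
  | Some Base => rcons (map work (nu_axiom N1)) x
  | Some Top => map out w1 ++ s
  | None => if x \in V2 then e2 x else [:: x]
  end.

(** The depth exceeds that of [N2] by the level that unfolds [Top]. *)
Definition combined : nu_system T :=
  NUSystem [fset x in combined_letters]%fset combined_rule [:: f Top]
    combined_coding (nu_depth N2).+1 n.

Hypothesis (wf1 : nu_wf N1) (wf2 : nu_wf N2).
Hypothesis (res1 : nu_resolves N1 e1) (res2 : nu_resolves N2 e2).
Hypothesis dec_role : {in roles, forall k, dec (f k) = Some k}.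
Hypothesis dec_old : {in (V1 `|` V2)%fset, forall A, dec A = None}.
Hypothesis out_letters : {in V1, forall A, out A \in combined_letters}.
Hypothesis s_vars : {subset s <= V2}.

Let dec1 : {in V1, forall A, dec A = None}.
Proof. by move=> A AV; apply: dec_old; rewrite inE AV. Qed.

Let dec2 : {in V2, forall A, dec A = None}.
Proof. by move=> A AV; apply: dec_old; rewrite inE AV orbT. Qed.

Let dec_work : {in V1, forall A, dec (work A) = Some (Work A)}.
Proof. by move=> A AV; apply: dec_role; rewrite !mem_cat map_f ?orbT. Qed.

Let dec_read : {in V1, forall A, dec (read A) = Some (Read A)}.
Proof. by move=> A AV; apply: dec_role; rewrite !mem_cat (map_f (@Read T)) ?orbT. Qed.

Let dec_final : {in V1, forall A, dec (final A) = Some (Final A)}.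
Proof. by move=> A AV; apply: dec_role; rewrite !mem_cat (map_f (@Final T)) ?orbT. Qed.

Let dec_base : dec (f Base) = Some Base.
Proof. by apply: dec_role; rewrite mem_cat. Qed.

Let dec_top : dec (f Top) = Some Top.
Proof. by apply: dec_role; rewrite mem_cat. Qed.

Let work_in : {in V1, forall A, work A \in combined_letters}.
Proof. by move=> A AV; rewrite !mem_cat (map_f work) ?orbT. Qed.

Let read_in : {in V1, forall A, read A \in combined_letters}.
Proof. by move=> A AV; rewrite !mem_cat (map_f read) ?orbT. Qed.

Lemma final_in : {in V1, forall A, final A \in combined_letters}.
Proof. by move=> A AV; rewrite !mem_cat (map_f final) ?orbT. Qed.

Lemma old1_in : {in V1, forall A, A \in combined_letters}.
Proof. by move=> A AV; rewrite !mem_cat mem_filter AV andbT; case: (A \in V2). Qed.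

Let old2_in : {in V2, forall A, A \in combined_letters}.
Proof. by move=> A AV; rewrite mem_cat AV. Qed.

Let base_in : f Base \in combined_letters.
Proof. by rewrite !mem_cat !inE eqxx !orbT. Qed.

Let top_in : f Top \in combined_letters.
Proof. by rewrite !mem_cat !inE eqxx !orbT. Qed.

Lemma combined_letters_ind (P : T -> Prop) :
  {in V2, forall A, P A} -> {in V1, forall A, A \notin V2 -> P A} ->
  {in V1, forall A, P (work A)} -> {in V1, forall A, P (read A)} ->
  {in V1, forall A, P (final A)} -> P (f Base) -> P (f Top) ->
  {in combined_letters, forall x, P x}.
Proof.
move=> P2 P1 Pw Pr Pf Pb Pt x; rewrite !mem_cat mem_filter !inE.
case/or4P=> [/P2 // | /andP[] /[swap] /P1 // | /mapP[A /Pw ? ->] // |].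
case/or4P=> [/mapP[A /Pr ? ->] // | /mapP[A /Pf ? ->] // | /eqP -> // | /eqP -> //].
Qed.

Let mem_vars x : (x \in nu_vars combined) = (x \in combined_letters).
Proof. exact: in_fset. Qed.

Lemma combined_wf : nu_wf combined.
Proof.
have [S1 cod1 pos1 rul1] := wf1; have [S2 cod2 pos2 rul2] := wf2.
split=> [x | x | x | x]; rewrite ?mem_vars.
- by rewrite inE => /eqP ->.
- move: x; apply: combined_letters_ind => [A AV|A AV AV2|A AV|A AV|A AV||];
    rewrite /= /combined_coding.
  + by rewrite dec2 // AV; apply/old2_in/cod2.
  + by rewrite dec1 // (negPf AV2); apply: old1_in.
  + by rewrite dec_work //; apply/work_in/cod1.
  + by rewrite dec_read //; apply/out_letters/cod1.
  + by rewrite dec_final //; apply: old1_in.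
  + by rewrite dec_base.
  + by rewrite dec_top.
- move: x; apply: combined_letters_ind => [A AV|A AV AV2|A AV|A AV|A AV||];
    rewrite /= /combined_rule.
  + by rewrite dec2 // AV; apply: pos2.
  + by rewrite dec1 // (negPf AV2).
  + by rewrite dec_work.
  + by rewrite dec_read // size_map; apply: pos1.
  + by rewrite dec_final.
  + by rewrite dec_base size_map size_rcons.
  + by rewrite dec_top.
- move=> xN; rewrite (eq_all (a2 := fun y => symbol_var y \in combined_letters)); last first.
    by move=> y; apply: mem_vars.
  move: x xN; apply: combined_letters_ind => [A AV|A AV AV2|A AV|A AV|A AV||];
    rewrite /= /combined_rule.
  + by rewrite dec2 // AV; apply: sub_all (rul2 A AV) => y /old2_in.
  + by rewrite dec1 // (negPf AV2) /= old1_in.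
  + by rewrite dec_work //= read_in.
  + rewrite dec_read // all_map; apply: sub_all (rul1 A AV) => -[B|B l i j] /= BV;
      exact: work_in.
  + by rewrite dec_final //= final_in.
  + rewrite dec_base all_map all_rcons /= base_in; apply/allP => _ /mapP[A AS ->] /=.
    by apply/work_in/S1.
  + by rewrite dec_top /= base_in all_map; apply/allP => A /s_vars /old2_in.
Qed.

(** * Resolution of the letters of the combined system *)

Let step_work : {in V1, forall A, combined_step (work A) = [:: read A]}.
Proof. by move=> A AV; rewrite /combined_step dec_work. Qed.

Let step_read : {in V1, forall A, combined_step (read A) = map work (e1 A)}.
Proof. by move=> A AV; rewrite /combined_step dec_read. Qed.

Let step_base : combined_step (f Base) = rcons (map work (nu_axiom N1)) (f Base).
Proof. by rewrite /combined_step dec_base. Qed.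

Let step_old : {in V2, forall A, combined_step A = e2 A}.
Proof. by move=> A AV; rewrite /combined_step dec2 // AV. Qed.

Let resolved_work : {in V1, forall A, resolved combined combined_step (work A)}.
Proof.
by move=> A AV; apply: resolved_Var; rewrite step_work //= /combined_rule dec_work.
Qed.

Let resolved_base : resolved combined combined_step (f Base).
Proof. by apply: resolved_Var; rewrite step_base /= /combined_rule dec_base. Qed.

(** An instance of the simulation with [k = 1]: the idle level is the passage from [Work] to
    [Read]. *)
Let resolved_read : {in V1, forall A, resolved combined combined_step (read A)}.
Proof.
move=> A AV; apply: (resolved_stretch (k := 1) (f := work) wf1 _ _ _ res1 AV).
- by move=> B BV; rewrite /= /combined_rule dec_read.
- by move=> B BV; rewrite /= /combined_coding dec_work.
- move=> B l u uV ru; rewrite addn1.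
  have -> : map read u = flatten (map combined_step (map work u)).
    elim: u uV {ru} => //= C u IHu uV; rewrite step_work ?uV ?mem_head //= -IHu // => D Du.
    by apply: uV; rewrite inE Du orbT.
  by apply: reads_flatten ru => _ /mapP[C Cu ->]; apply/resolved_work/uV.
- exact: step_read.
Qed.

Let resolved_old : {in V2, forall A, resolved combined combined_step A}.
Proof.
move=> A AV; apply: (resolved_stretch (k := 0) (f := id) (g := id) wf2 _ _ _ res2 AV).
- by move=> B BV; rewrite /= /combined_rule dec2 // BV map_stretch_id.
- by move=> B BV; rewrite /= /combined_coding dec2 // BV.
- by move=> B l u _; rewrite addn0 map_id.
- by rewrite map_id step_old.
Qed.

(** Two levels, [Work] to [Read] and [Read] to the rewritten right-hand side, make one level of the
    first system. *)
Lemma expand_work l u : {subset u <= V1} ->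
  expand combined_step (l * 2) (map work u) = map work (expand e1 l u).
Proof.
move=> uV; elim: l => //= l IHl; rewrite IHl.
have: {subset expand e1 l u <= V1}.
  by apply: sub_expand uV => A; apply: resolved_in_vars res1.
elim: (expand e1 l u) => //= A v IHv AvV.
rewrite step_work ?AvV ?mem_head //= step_read ?AvV ?mem_head // map_cat IHv //.
by move=> B Bv; apply: AvV; rewrite inE Bv orbT.
Qed.

Lemma expand_old l u : {subset u <= V2} -> expand combined_step l u = expand e2 l u.
Proof.
move=> uV; elim: l => //= l ->; congr flatten; apply/eq_in_map => A Au.
apply/step_old/(sub_expand _ uV Au) => B; exact: resolved_in_vars res2.
Qed.

Lemma expand_final l u : {subset u <= V1} ->
  expand combined_step l (map final u) = map final u.
Proof.
move=> uV; elim: l => //= l ->; elim: u uV => //= A u IHu uV.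
rewrite {1}/combined_step dec_final ?uV ?mem_head //= IHu // => B Bu.
by apply: uV; rewrite inE Bu orbT.
Qed.

Lemma coding_final u : {subset u <= V1} -> map combined_coding (map final u) = u.
Proof.
move=> uV; rewrite -map_comp -[RHS]map_id; apply/eq_in_map => A /uV AV /=.
by rewrite /combined_coding dec_final.
Qed.

Lemma coding_old u : {subset u <= V2} -> map combined_coding u = map (nu_coding N2) u.
Proof.
move=> uV; apply/eq_in_map => A /uV AV.
by rewrite /combined_coding dec2 // AV.
Qed.

Let reads_base : exists v, reads combined (f Base) (nu_depth N1 * 2).+2
  (map read (expand e1 (nu_depth N1) (nu_axiom N1)) ++ v).
Proof.
have [S1 _ _ _] := wf1.
(* [Top] stays outside [U]: its own resolution rests on this reading. *)
pose U := [pred x in map work V1 ++ map read V1 ++ [:: f Base]].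
(* The remainder [v] stems from the copy of [Base] at the end of its rule. *)
exists (expand combined_step (nu_depth N1 * 2).+1 [:: f Base]).
suff <- : expand combined_step (nu_depth N1 * 2).+2 [:: f Base] =
  map read (expand e1 (nu_depth N1) (nu_axiom N1)) ++
    expand combined_step (nu_depth N1 * 2).+1 [:: f Base].
  apply: (reads_expand (U := U)); last by rewrite !inE !mem_cat mem_head !orbT.
    move=> x; rewrite !inE !mem_cat => /or3P[/mapP[A AV ->]|/mapP[A AV ->]|].
    - exact: resolved_work.
    - exact: resolved_read.
    - by rewrite inE => /eqP ->.
  move=> x; rewrite !inE !mem_cat => /or3P[/mapP[A AV ->]|/mapP[A AV ->]|/[1!inE] /eqP ->] y.
  - by rewrite step_work // inE => /eqP ->; rewrite !inE !mem_cat (map_f read) // orbT.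
  - rewrite step_read // => /mapP[B /(resolved_in_vars wf1 res1 AV) BV ->].
    by rewrite !inE mem_cat map_f.
  - rewrite step_base mem_rcons !inE !mem_cat.
    case/predU1P=> [-> | /mapP[A /S1 AV ->]]; first by rewrite mem_head !orbT.
    by rewrite (map_f work).
have baseE : flatten (map combined_step [:: f Base]) = map work (nu_axiom N1) ++ [:: f Base].
  by rewrite /= cats0 step_base cats1.
rewrite [LHS]expandSr baseE expand_cat; congr (_ ++ _) => /=.
rewrite expand_work //.
have: {subset expand e1 (nu_depth N1) (nu_axiom N1) <= V1}.
  by apply: sub_expand S1 => A; apply: resolved_in_vars res1.
elim: (expand _ _ _) => //= A v IHv AvV; rewrite step_work ?AvV ?mem_head //= IHv //.
by move=> B Bv; apply: AvV; rewrite inE Bv orbT.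
Qed.

Let resolved_top : resolved combined combined_step (f Top).
Proof.
have [S1 _ _ _] := wf1.
have topE : nu_rule combined (f Top) =
    Ext (f Base) (nu_depth N1 * 2).+2 1 (size w1) :: map (@Var T) s.
  by rewrite /= /combined_rule dec_top.
have stepE : combined_step (f Top) = map out w1 ++ s by rewrite /combined_step dec_top.
rewrite /resolved stepE /rule_len topE /= sumn_symbol_len_Var size_cat size_map subn1.
(* Positions below [size w1] come from the extraction, the others from [s]. *)
split=> // p pws; rewrite nth_cat size_map; case: ltnP => [pw | wp].
  have [v rv] := reads_base; set L := expand _ _ _ in rv.
  have LV : {subset L <= V1}.
    by apply: sub_expand S1 => A; apply: resolved_in_vars res1.
  have pL: p < size L.
    by apply: leq_trans pw _; rewrite /w1 size_map size_take_min geq_minr.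
  have cV: nth (f Top) L p \in V1 by apply/LV/mem_nth.
  (* With the lower bound 1, the 0-based position [p] of the extracted string copies position [p] of
     the level of [Base]; this is a [Read] letter, whose coding applies [out]. *)
  have := @RuleAtExt T combined (f Top) [::] (f Base) (nu_depth N1 * 2).+2 1 (size w1)
    (map (@Var T) s) p (read (nth (f Top) L p)) topE pw.
  rewrite subn1 /= /combined_coding dec_read // (nth_map (f Top)) //.
  have pt: p < nu_length N1.
    by apply: leq_trans pw _; rewrite /w1 size_map size_take_min geq_minl.
  rewrite /w1 (nth_map (f Top)); last by rewrite size_map in pw.
  rewrite nth_take //; apply.
  have := rv p; rewrite size_cat size_map nth_cat size_map pL (nth_map (f Top)) //.
  by apply; rewrite ltn_addr.
have := @rule_at_Var T combined (f Top) [:: Ext (f Base) (nu_depth N1 * 2).+2 1 (size w1)]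
  s (p - size w1) topE.
by rewrite /= subn1 addn0 /= subnKC // ltn_subLR //; apply.
Qed.

Lemma combined_resolves : nu_resolves combined combined_step.
Proof.
move=> x; rewrite mem_vars; move: x.
(* The two kinds left open are the idle letters: those of [V1] outside [V2], and the [Final]
   ones. *)
apply: combined_letters_ind => // [A AV AV2 | A AV].
  by apply: resolved_Var; rewrite /= /combined_rule /combined_step dec1 // (negPf AV2).
by apply: resolved_Var; rewrite /= /combined_rule /combined_step dec_final.
Qed.

Lemma combined_valid : nu_valid combined.
Proof. by split; [apply: combined_wf | exists combined_step; apply: combined_resolves]. Qed.

Lemma combined_generates :
  nu_generates combined
    (map combined_coding
       (take n (expand combined_step (nu_depth N2) (map out w1 ++ s)))).
Proof.
exists combined_step; first exact: combined_resolves.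
have topE : flatten (map combined_step [:: f Top]) = map out w1 ++ s.
  by rewrite /= cats0 /combined_step dec_top.
by rewrite [nu_depth combined]/= expandSr topE.
Qed.

(** Rules of the first system are nonempty, so [V1] has at most as many letters as its rules have
    symbols. These rules are thus paid four times: once for [Read], and once each for the one-symbol
    rules of [Work], [Final] and the old letters. The 3 counts the axiom, the trailing [Base] and
    the extraction in [Top]. *)
Lemma combined_size : size s <= size (nu_axiom N2) ->
  nu_size combined <= 4 * (nu_size N1 + nu_size N2) + 3.
Proof.
move=> sS; have [_ _ pos1 _] := wf1.
have card1 : size V1 <= \sum_(A <- V1) size (nu_rule N1 A).
  by rewrite -sum1_size !big_seq; apply: leq_sum => A /pos1.
have bound : \sum_(A <- nu_vars combined) size (combined_rule A) <=
    \sum_(A <- combined_letters) size (combined_rule A).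
  have lettersE : perm_eq (nu_vars combined) (undup combined_letters).
    by apply: uniq_perm; rewrite ?fset_uniq ?undup_uniq // => x; rewrite mem_vars mem_undup.
  rewrite (perm_big _ lettersE); exact: leq_sum_undup.
rewrite /nu_size /= -/V1 -/V2.
apply: leq_trans (leq_add (leqnn 1) bound) _.
rewrite /combined_letters !big_cat /= !big_map !big_cons big_nil.
have -> : \sum_(A <- V2) size (combined_rule A) = \sum_(A <- V2) size (nu_rule N2 A).
  by apply: eq_big_seq => A AV; rewrite /combined_rule dec2 // AV.
have old : \sum_(A <- [seq A <- V1 | A \notin V2]) size (combined_rule A) <= size V1.
  apply: leq_trans (count_size (fun A => A \notin V2) _); rewrite -size_filter -sum1_size.
  rewrite leq_eqVlt; apply/orP; left; apply/eqP/eq_big_seq => A.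
  by rewrite mem_filter /combined_rule => /andP[/negPf AV2 /dec1 ->]; rewrite AV2.
have -> : \sum_(A <- V1) size (combined_rule (work A)) = size V1.
  by rewrite -sum1_size; apply: eq_big_seq => A AV; rewrite /combined_rule dec_work.
have -> : \sum_(A <- V1) size (combined_rule (read A)) = \sum_(A <- V1) size (nu_rule N1 A).
  by apply: eq_big_seq => A AV; rewrite /combined_rule dec_read // size_map.
have -> : \sum_(A <- V1) size (combined_rule (final A)) = size V1.
  by rewrite -sum1_size; apply: eq_big_seq => A AV; rewrite /combined_rule dec_final.
have -> : size (combined_rule (f Base)) = (size (nu_axiom N1)).+1.
  by rewrite /combined_rule dec_base size_map size_rcons size_map.
have -> : size (combined_rule (f Top)) = (size s).+1.
  by rewrite /combined_rule dec_top /= size_map.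
lia.
Qed.

End Combination.

(** * Concatenation and composition as two instances *)

Theorem theorem9 :
  exists K : nat,
  forall (T : choiceType) (T_infinite : forall X : {fset T}, exists x : T, x \notin X)
         (N1 N2 : nu_system T) (w1 w2 : seq T),
    nu_valid N1 -> nu_valid N2 ->
    nu_generates N1 w1 -> nu_generates N2 w2 ->
    (exists N : nu_system T,
       [/\ nu_valid N,
           nu_generates N (w1 ++ w2) &
           nu_size N <= K * (nu_size N1 + nu_size N2)])
    /\
    ({subset w1 <= nu_vars N2} ->
     exists (N : nu_system T) (w : seq T),
       [/\ nu_generates (nu_with_axiom N2 w1) w,
           nu_valid N,
           nu_generates N w &
           nu_size N <= K * (nu_size N1 + nu_size N2)]).
Proof.
(* For a positive total size [m], [4 * m + 3 <= 7 * m]. *)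
exists 7 => T T_infinite N1 N2 w1 w2 val1 val2 gen1 gen2.
have [wf1 _] := val1; have [wf2 _] := val2.
have [e1 res1 w1E] := gen1; have [e2 res2 w2E] := gen2.
have [S1 cod1 _ _] := wf1; have [S2 cod2 _ _] := wf2.
(* Resolution does not depend on the axiom: [N2] is simulated, with no idle level, by its variant
   with axiom [u]. *)
have with_axiom u : nu_generates (nu_with_axiom N2 u)
    (map (nu_coding N2) (take (nu_length N2) (expand e2 (nu_depth N2) u))).
  exists e2 => // A AV.
  apply: (resolved_stretch (k := 0) (f := id) (g := id) wf2 _ _ _ res2 AV) => //.
  - by move=> B _; rewrite map_stretch_id.
  - by move=> B l v _; rewrite addn0 map_id.
  - by rewrite map_id.
(* Total size 0 leaves no room for the additive constant. Both axioms are then empty, and so are all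
   strings involved, hence [N1] itself serves. *)
have [size0 | size_gt0] := posnP (nu_size N1 + nu_size N2).
  have axiom0 N : nu_size N = 0 -> nu_axiom N = [::].
    by move/eqP; rewrite addn_eq0 => /andP[/nilP].
  have expand0 e l : expand e l [::] = [::] :> seq T by elim: l => //= l ->.
  have [size1 size2] : nu_size N1 = 0 /\ nu_size N2 = 0 by lia.
  have w10 : w1 = [::] by rewrite w1E axiom0 // expand0.
  have w20 : w2 = [::] by rewrite w2E axiom0 // expand0.
  rewrite w20 {w20} w10 in gen1 *.
  split=> [|_]; first by exists N1; split; rewrite ?size1.
  exists N1, [::]; split=> //; rewrite ?size1 //.
  by have := with_axiom [::]; rewrite expand0.
have size7 m : m <= 4 * (nu_size N1 + nu_size N2) + 3 -> m <= 7 * (nu_size N1 + nu_size N2).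
  by lia.
have [f [dec [dec_role dec_old]]] :=
  fresh_coding T_infinite (roles N1) (nu_vars N1 `|` nu_vars N2)%fset.
have dec2 A : A \in nu_vars N2 -> dec A = None.
  by move=> AV; apply: dec_old; rewrite inE AV orbT.
have w1V : {subset w1 <= nu_vars N1}.
  rewrite w1E => _ /mapP[A /mem_take AL ->]; apply/cod1/(sub_expand _ S1 AL) => B.
  exact: resolved_in_vars res1.
split=> [|w1V2].
  (* Coding into [Final] freezes [w1] during the expansion of the second axiom. The length
     [size w1 + nu_length N2] keeps this block whole and cuts only the second part. *)
  exists (combined N1 N2 e1 f dec (fun A => f (Final A)) (nu_axiom N2) (size w1 + nu_length N2)).
  split; last exact/size7/combined_size.
    by apply: (combined_valid _ wf1 wf2 res1 res2) => //; apply: final_in.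
  have := combined_generates (fun A => f (Final A)) (nu_axiom N2) (size w1 + nu_length N2)
    wf1 wf2 res1 res2 dec_role dec_old.
  rewrite -w1E expand_cat (expand_old _ _ _ _ wf2 res2 dec_old _ S2).
  rewrite (expand_final _ _ _ _ _ dec_role _ w1V) take_cat size_map ltnNge leq_addr /= addKn.
  rewrite map_cat (coding_final _ _ dec_role w1V) (coding_old _ _ dec_old) -?w2E //.
  move=> A /mem_take; apply: sub_expand => // B; exact: resolved_in_vars res2.
(* With [out] the identity and [s] empty, [Top] unfolds to [w1] itself, whose letters the rules of
   [N2] go on expanding. *)
exists (combined N1 N2 e1 f dec id [::] (nu_length N2)).
exists (map (nu_coding N2) (take (nu_length N2) (expand e2 (nu_depth N2) w1))).
split; [exact: with_axiom | | | exact/size7/combined_size].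
  by apply: (combined_valid _ wf1 wf2 res1 res2) => //; apply: old1_in.
have := combined_generates id [::] (nu_length N2) wf1 wf2 res1 res2 dec_role dec_old.
rewrite -w1E map_id cats0 (expand_old _ _ _ _ wf2 res2 dec_old _ w1V2).
rewrite (coding_old _ _ dec_old) // => A /mem_take; apply: sub_expand => // B.
exact: resolved_in_vars res2.
Qed.
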